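(* For any irrational $\alpha\in\mathbb{R}$, any $\gamma\in\mathbb{R}$ and any $\epsilon>0$ there are infinitely many pairs of coprime integers $m,n$ with $n\neq 0$ such that $$\left|n\alpha-m-\gamma\right|\le\frac{1}{|n|^{1-\epsilon}}.$$
   Context: Integers $m,n$ (of any sign) are coprime if $\gcd(m,n)=1$. *)

(* Defs.v *)
From mathcomp Require Import all_boot all_order all_algebra.
From mathcomp Require Import all_classical all_reals exp.

(* Main.v *)
Require Import Defs.
From mathcomp Require Import all_boot all_order all_algebra.
From mathcomp Require Import all_classical all_reals exp.
From mathcomp Require Import zify ring lra.

(** Write an integer vector (n, m) in a basis (q, p), (q', p') of Z^2, where
    p / q is a good rational approximation of alpha and 0 <= q' < q.  Both basis
    vectors have linear form n alpha - m of size at most 2 / q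
    ([lattice_point]), and the equations n = 0, n alpha - m = gamma have the
    real solution (xi, eta) = (- gamma q', gamma q) in the basis coordinates.
    For H >= 1, an integer point (x, y) at distance O(H) from (xi, eta) hence has
    n = O(H q) and error |n alpha - m - gamma| = O(H / q), so the product of
    the two is O(H ^ 2), and q can be as large as desired by Dirichlet's theorem
    ([coprime_dirichlet]).

    A change of basis of Z^2 preserves coprimality, so it remains to choose
    x and y coprime.  Fix x nonzero within 3 of xi.  The sieve of Eratosthenes over the
    omega(x) prime divisors of x makes an error of at most 2 ^ omega(x), while
    the density of the integers coprime to x is at least 2 ^ - omega(x): every
    interval of length 4 ^ omega(x) contains an integer coprime to x
    ([coprime_in_interval]), so H = 4 ^ omega(x) is allowed.

    Finally x = O(q) and 4 ^ omega(x) = O(x ^ d) for all d > 0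
    ([exp_size_primes_subpolynomial]), so the factors of H are absorbed by the
    loss of n ^ eps that the theorem concedes ([powR_absorb]). *)

Import Order.TTheory GRing.Theory Num.Theory.
Local Open Scope classical_set_scope.
Local Open Scope ring_scope.

(** * Sieving an interval by finitely many primes *)

Definition unsieved (s : seq nat) (n : nat) : bool :=
  all (fun p => ~~ (p %| n)%N) s.

Definition unsieved_count (s : seq nat) (n : nat) : nat :=
  (\sum_(1 <= j < n.+1) unsieved s j)%N.

Definition sieve_density (s : seq nat) : rat := \prod_(p <- s) (1 - p%:R^-1).

Lemma unsieved_countS s n :
  unsieved_count s n.+1 = (unsieved_count s n + unsieved s n.+1)%N.
Proof. by rewrite /unsieved_count big_nat_recr. Qed.

Lemma unsieved_count_nil n : unsieved_count [::] n = n.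
Proof.
elim: n => [|n IH]; first by rewrite /unsieved_count big_geq.
by rewrite unsieved_countS IH addn1.
Qed.

Lemma unsieved_mul p s n : prime p -> all prime s -> p \notin s ->
  unsieved s (p * n) = unsieved s n.
Proof.
move=> pp; elim: s => //= q s IH /andP[pq ps]; rewrite inE negb_or.
case/andP=> pNq pNs; rewrite IH // Euclid_dvdM // dvdn_prime2 //.
by rewrite [q == p]eq_sym (negPf pNq).
Qed.

(** The Legendre recursion: the integers up to [n] that survive [s] but are
    removed by [p] are the multiples [p * i] where [i <= n / p] survives [s]. *)
Lemma unsieved_count_cons p s n : prime p -> all prime s -> p \notin s ->
  (unsieved_count (p :: s) n + unsieved_count s (n %/ p) = unsieved_count s n)%N.
Proof.
move=> pp ps pNs; elim: n => [|n IH].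
  by rewrite div0n /unsieved_count !big_geq.
rewrite !unsieved_countS -IH divnS ?prime_gt0 //=.
case: (boolP (p %| n.+1)%N) => [pn|_] /=; last by rewrite add0n; lia.
rewrite add1n unsieved_countS -(unsieved_mul p s) //.
suff -> : (p * (n %/ p).+1 = n.+1)%N by lia.
by move: (divnS n (prime_gt0 pp)); rewrite pn add1n => <-; rewrite mulnC divnK.
Qed.

Lemma sieve_density_itv s : all prime s -> 0 <= sieve_density s <= 1.
Proof.
rewrite /sieve_density; elim: s => [|p s IH] /=; first by rewrite big_nil.
case/andP=> pp /IH /andP[h0 h1]; rewrite big_cons.
have : 0 < (p%:R : rat)^-1 <= 1.
  by rewrite invr_gt0 ltr0n invf_le1 ?ler1n ?ltr0n prime_gt0.
nra.
Qed.

Lemma sieve_density_ge s : all prime s -> 2^-1 ^+ size s <= sieve_density s.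
Proof.
rewrite /sieve_density; elim: s => [|p s IH] /=; first by rewrite big_nil.
case/andP=> pp /IH h; rewrite big_cons exprS.
have h2 : (p%:R : rat)^-1 <= 2^-1.
  by rewrite lef_pV2 ?posrE ?ltr0n ?prime_gt0 // ler_nat prime_gt1.
apply: ler_pM => //; first by rewrite exprn_ge0.
lra.
Qed.

Lemma divn_length p a b : (0 < p)%N ->
  `|(b %/ p)%:R - (a %/ p)%:R - (b%:R - a%:R) * p%:R^-1| <= (1 : rat).
Proof.
move=> p0; have P : 0 < (p%:R : rat) by rewrite ltr0n.
have H c : (c %/ p)%:R <= (c%:R : rat) / p%:R < (c %/ p)%:R + 1.
  rewrite ler_pdivlMr // ltr_pdivrMr // natr1 -!natrM ler_nat ltr_nat.
  by rewrite leq_divM ltn_ceil.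
rewrite ler_norml mulrBl; move: (H a) (H b); lra.
Qed.

(** Each new prime p subtracts the same count over the interval (a / p, b / p],
    whose length differs from (b - a) / p by at most 1 by [divn_length].  The
    error bound hence passes from E to 2 E + 1, which gives 2 ^ k - 1. *)
Lemma sieve_error s a b : all prime s -> uniq s ->
  `|(unsieved_count s b)%:R - (unsieved_count s a)%:R
     - (b%:R - a%:R) * sieve_density s| <= (2 ^+ size s - 1 : rat).
Proof.
elim: s a b => [|p s IH] a b /=.
  by move=> _ _; rewrite !unsieved_count_nil /sieve_density big_nil mulr1 !subrr normr0.
case/andP=> pp ps /andP[pNs us].
have E n : (unsieved_count (p :: s) n)%:R =
    (unsieved_count s n)%:R - (unsieved_count s (n %/ p))%:R :> rat.
  by rewrite -(unsieved_count_cons p s n pp ps pNs) natrD addrK.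
move: (IH a b ps us) (IH (a %/ p)%N (b %/ p)%N ps us).
rewrite !E /sieve_density big_cons -/(sieve_density s) exprS.
set d := sieve_density s; set u := _^-1.
have : `|((b %/ p)%:R - (a %/ p)%:R - (b%:R - a%:R) * u) * d| <= (1 : rat).
  have /andP[d0 d1] := sieve_density_itv s ps.
  by rewrite normrM (ger0_norm d0) mulr_ile1 // divn_length // prime_gt0.
rewrite !ler_norml; lra.
Qed.

(** With k prime divisors, 4 ^ k consecutive integers have an expected number of
    survivors of at least 4 ^ k / 2 ^ k = 2 ^ k, which exceeds the sieve error
    2 ^ k - 1. *)
Lemma coprime_in_interval x a : (0 < x)%N ->
  exists2 j, (a < j <= a + 4 ^ size (primes x))%N & coprime x j.
Proof.
move=> x0; set s := primes x; set b := (a + _)%N.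
have ps : all prime s by apply/allP => p; rewrite mem_primes => /andP[].
have lt_count : (unsieved_count s a < unsieved_count s b)%N.
  rewrite -(ltr_nat rat).
  have := sieve_error s a b ps (primes_uniq x).
  have -> : b%:R - a%:R = 4 ^+ size s :> rat by rewrite /b natrD natrX addrC addKr.
  rewrite ler_norml => /andP[+ _].
  have : 2 ^+ size s <= 4 ^+ size s * sieve_density s.
    have {1}-> : 2 ^+ size s = 4 ^+ size s * 2^-1 ^+ size s :> rat.
      by rewrite -exprMn; congr (_ ^+ _).
    by rewrite ler_pM2l ?exprn_gt0 // sieve_density_ge.
  lra.
have [j jab /allP js] : exists2 j, (a < j <= b)%N & unsieved s j.
  apply: contrapT => none; move: lt_count; apply/negP; rewrite -leqNgt.
  have le_ab : (a.+1 <= b.+1)%N by rewrite ltnS leq_addr.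
  rewrite /unsieved_count (big_cat_nat _ le_ab) //=.
  rewrite [X in (_ + X)%N]big1_seq ?addn0 // => j /andP[_].
  rewrite mem_index_iota ltnS => jab.
  by case us: (unsieved s j) => //; case: none; exists j.
exists j => //; case: (posnP j) jab => [->|j0 jab]; first by rewrite ltn0.
rewrite coprime_has_primes //; apply/hasPn => p; rewrite mem_primes => /and3P[_ _ pj].
by apply/negP => /js; rewrite pj.
Qed.

(** * The growth of 4 ^ omega(x) *)

(** At most [T] prime divisors of [x] are below [T]; they account for the factor
    [T ^ T].  Replacing [T] by the prime itself for each of the others gives a
    divisor of [x]. *)
Lemma expn_size_primes_le T x : (0 < x)%N ->
  (T ^ size (primes x) <= T ^ T * x)%N.
Proof.
move=> x0; case: (posnP T) => [->|T0].
  by rewrite expn0 mul1n; case: (size _) => // k; rewrite exp0n.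
have small : (count (fun p => p < T) (primes x) <= T)%N.
  rewrite -size_filter -[X in (_ <= X)%N](size_iota 0).
  apply: uniq_leq_size; first by rewrite filter_uniq ?primes_uniq.
  by move=> p; rewrite mem_filter mem_iota => /andP[].
have prodE : (\prod_(p <- primes x) p ^ logn p x = x)%N.
  by rewrite [RHS]prod_prime_decomp // prime_decompE big_map.
apply: (@leq_trans (T ^ count (fun p => p < T)%N (primes x) * x)%N); last first.
  by rewrite leq_mul2r leq_pexp2l ?orbT.
rewrite -{3}prodE.
have : all (fun p => prime p && (0 < logn p x)%N) (primes x).
  by apply/allP => p px; rewrite logn_gt0 px andbT; move: px; rewrite mem_primes => /andP[].
elim: (primes x) => [|p s IH] /=; first by rewrite big_nil.
case/andP=> /andP[pp lp] /IH {}IH; rewrite big_cons expnS.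
have ple : (p <= p ^ logn p x)%N by rewrite -{1}[p]expn1 leq_exp2l ?prime_gt1.
have p0 := prime_gt0 pp.
case: (ltnP p T) => pT /=.
  by rewrite expnS -mulnA leq_mul2l (leq_trans IH) ?orbT // leq_mul2l
    leq_pmull ?orbT // expn_gt0 p0.
by rewrite add0n mulnCA leq_mul // (leq_trans pT).
Qed.

(** Take T with 4 <= T ^ d; then 4 ^ omega(x) <= (T ^ omega(x)) ^ d, and
    [expn_size_primes_le] bounds the base by T ^ T x. *)
Lemma exp_size_primes_subpolynomial (R : realType) (d : R) : 0 < d ->
  exists2 C : R, 0 < C &
    forall x, (0 < x)%N -> (4 ^ size (primes x))%N%:R <= C * x%:R `^ d.
Proof.
move=> d0; set r := 4 `^ d^-1 : R.
have r0 : 0 < r by rewrite powR_gt0.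
set T := Num.bound r.
have rT : r < T%:R by rewrite archi_boundP // ltW.
have T4 : 4 <= T%:R `^ d :> R.
  have -> : 4 = r `^ d by rewrite -powRrM mulVf ?gt_eqF // powRr1.
  by rewrite ge0_ler_powR ?nnegrE // ltW.
exists ((T ^ T)%:R `^ d); first by rewrite powR_gt0 // ltr0n expn_gt0 -(ltr0n R) (lt_trans r0).
move=> x x0; rewrite -powRM // -natrM.
apply: (@le_trans _ _ ((T ^ size (primes x))%:R `^ d)); last first.
  by rewrite ge0_ler_powR ?nnegrE ?ler_nat ?expn_size_primes_le // ltW.
have -> : (T ^ size (primes x))%:R `^ d = (T%:R `^ d) ^+ size (primes x) :> R.
  by rewrite natrX -powR_mulrn // powRAC powR_mulrn ?powR_ge0.
by rewrite natrX lerXn2r ?nnegrE ?powR_ge0.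
Qed.

(** * Dirichlet approximation *)

(** Pigeonhole: two of the N + 1 fractional parts of 0, a, ..., N a lie in the same
    interval of length 1 / N. *)
Lemma dirichlet (R : realType) (a : R) (N : nat) : (0 < N)%N ->
  exists q : nat, exists2 p : int, (0 < q <= N)%N &
    `|q%:R * a - p%:~R| < N%:R^-1.
Proof.
move=> N0; have NR : 0 < N%:R :> R by rewrite ltr0n.
pose fl (i : nat) := Num.floor (i%:R * a).
pose g (i : nat) := N%:R * (i%:R * a - (fl i)%:~R).
have g0 i : 0 <= g i by rewrite mulr_ge0 ?subr_ge0 ?floor_le // ltW.
have gN i : (Num.truncn (g i) < N)%N.
  rewrite truncn_lt_nat // gtr_pMr // ltrBlDr addrC.
  by have /andP[_] := floor_itv (i%:R * a); rewrite intrD.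
pose f (i : 'I_N.+1) : 'I_N := Ordinal (gN i).
have /injectivePn[i [j nij fij]] : ~~ injectiveb f.
  by apply/negP => /injectiveP /leq_card; rewrite !card_ord ltnn.
have {fij} : Num.truncn (g i) = Num.truncn (g j) by case: fij.
wlog ltij : i j nij / (i < j)%N.
  move=> W e; have : (i : nat) != j by [].
  by rewrite neq_ltn => /orP[/W|/W]; apply => //; rewrite eq_sym.
move=> e; exists (j - i)%N, (fl j - fl i).
  by rewrite subn_gt0 ltij (leq_trans (leq_subr _ _)) // -ltnS.
rewrite -(ltr_pM2l NR) divff ?gt_eqF // -{1}(gtr0_norm NR) -normrM.
rewrite natrB ?(ltnW ltij) // intrB.
have /andP[h1 h2] := truncn_itv (g0 i); have /andP[h3 h4] := truncn_itv (g0 j).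
have -> : N%:R * ((j%:R - i%:R) * a - ((fl j)%:~R - (fl i)%:~R)) = g j - g i.
  by rewrite /g; ring.
rewrite e -natr1 in h1 h2; rewrite -natr1 in h4.
rewrite ltr_norml; lra.
Qed.

(** Forces the denominators given by [dirichlet] to infinity: an error below the
    gap for [B] excludes every denominator up to [B]. *)
Lemma irrational_gap (R : realType) (a : R) (B : nat) : irrational a ->
  exists2 eta : R, 0 < eta & forall (q : nat) (p : int),
    (0 < q <= B)%N -> eta <= `|q%:R * a - p%:~R|.
Proof.
move=> aI; elim: B => [|B [eta eta0 IH]].
  by exists 1 => // q p; rewrite leqn0; case: q.
set r := B.+1%:R * a; set f := Num.floor r.
have /andP[f1 f2] := floor_itv r; rewrite -/f intrD in f1 f2.
have {}f1 : f%:~R < r.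
  rewrite lt_neqAle f1 andbT; apply/eqP => fr; apply: aI.
  by apply/rationalP; exists f, B.+1; rewrite fr /r mulrAC divff ?mul1r ?pnatr_eq0.
exists (Num.min eta (Num.min (r - f%:~R) (f%:~R + 1 - r))).
  by rewrite !lt_min eta0 !subr_gt0 f1.
move=> q p /andP[q0]; rewrite leq_eqVlt => /orP[/eqP->|qB]; last first.
  by rewrite ge_min IH // q0.
rewrite -/r !ge_min; apply/orP; right.
case: (lerP p f) => pf.
  have : p%:~R <= f%:~R :> R by rewrite ler_int.
  apply: contraTT; rewrite negb_or -!ltNge !ltr_norml.
  by case/andP=> /andP[? ?] /andP[? ?]; lra.
have : (f + 1)%:~R <= p%:~R :> R by rewrite ler_int lezD1.
rewrite intrD; apply: contraTT; rewrite negb_or -!ltNge !ltr_norml.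
by case/andP=> /andP[? ?] /andP[? ?]; lra.
Qed.

(** Dividing the pair given by [dirichlet] by its gcd does not increase the error,
    so the reduced denominator still exceeds [B] by [irrational_gap]. *)
Lemma coprime_dirichlet (R : realType) (a : R) (B : nat) : irrational a ->
  exists q : nat, exists p : int,
    [/\ (B < q)%N, coprimez p q & `|q%:R * a - p%:~R| <= q%:R^-1].
Proof.
move=> /(irrational_gap R a B)[eta eta0 gap].
have e0 : 0 <= eta^-1 by rewrite invr_ge0 ltW.
set N := Num.bound eta^-1.
have NR : eta^-1 < N%:R by rewrite archi_boundP.
have NR0 : 0 < N%:R :> R by apply: le_lt_trans NR.
have N0 : (0 < N)%N by rewrite -(ltr0n R).
have [q [p /andP[q0 qN] qp]] := dirichlet R a N N0.
set d := gcdn `|p| q.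
have d0 : (0 < d)%N by rewrite gcdn_gt0 q0 orbT.
have /dvdnP[q' qE] : (d %| q)%N by apply: dvdn_gcdr.
have /dvdzP[p' pE] : (d %| p)%Z by apply: dvdn_gcdl.
have q'0 : (0 < q')%N by move: q0; rewrite qE muln_gt0 => /andP[].
have small : `|q'%:R * a - p'%:~R| < N%:R^-1.
  apply: le_lt_trans qp.
  have -> : q%:R * a - p%:~R = d%:R * (q'%:R * a - p'%:~R).
    by rewrite pE {1}qE natrM intrM; ring.
  by rewrite normrM normr_nat ler_peMl // ler1n.
exists q', p'; split.
- rewrite ltnNge; apply/negP => q'B.
  have := gap q' p'; rewrite q'0 q'B => /(_ isT).
  apply/negP; rewrite -ltNge (lt_le_trans small) ?ltW //.
  by rewrite invf_plt // posrE.
- rewrite coprimezE /coprime -(eqn_pmul2r d0) mul1n muln_gcdl.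
  have -> : (`|p'| * d = `|p|)%N by rewrite pE abszM.
  by rewrite absz_nat -qE.
- apply: (le_trans (ltW small)).
  rewrite lef_pV2 ?posrE ?ltr0n // ler_nat (leq_trans _ qN) // qE leq_pmulr //.
Qed.

(** * Coprime points close to an inhomogeneous target *)

(** The integer [x] is the first coordinate of (n, m) in the basis (q, p), (q', p').
    It appears in the conclusion because the length [H] of the search interval
    for the second coordinate depends on its number of prime divisors. *)
Lemma lattice_point (R : realType) (a c : R) (q : nat) (p : int) :
  (0 < q)%N -> coprimez p q -> `|q%:R * a - p%:~R| <= q%:R^-1 ->
  exists m n x : int, let H : R := (4 ^ size (primes `|x|%N))%N%:R in
    [/\ coprimez m n, x != 0 /\ `|x|%N%:R <= (`|c| + 3) * q%:R,
        (q%:R : R) <= n%:~R <= 4 * H * q%:R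
      & `|n%:~R * a - m%:~R - c| <= 5 * H / q%:R].
Proof.
move=> q0 cpq err_e.
have Q1 : 1 <= q%:R :> R by rewrite ler1n.
(* a Bezout relation, reduced modulo q, completes (q, p) to a basis of Z^2 *)
have [q' [p' [q'0 q'q det]]] : exists q' p' : int,
    [/\ 0 <= q', q' < q & q' * p - q%:Z * p' = 1].
  have [[u v] /= uv] := coprimezP _ _ cpq.
  have qz : q%:Z != 0 by rewrite gt_eqF.
  exists (u %% q)%Z, (- (v + (u %/ q)%Z * p)); split.
  - exact: modz_ge0.
  - exact: ltz_pmod.
  - by rewrite -uv [in RHS](divz_eq u q); ring.
set e : R := q%:R * a - p%:~R; rewrite -/e in err_e.
set e' : R := q'%:~R * a - p'%:~R.
have detR : q'%:~R * p%:~R - q%:R * p'%:~R = 1 :> R.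
  by have := congr1 (fun z => z%:~R : R) det; rewrite intrB !intrM.
have detE : q%:R * e' - q'%:~R * e = 1 by rewrite /e /e' -[RHS]detR; ring.
have r0 : 0 <= q'%:~R :> R by rewrite ler0z.
have rq : q'%:~R <= q%:R :> R by rewrite -[q%:R]/(q%:~R) ler_int ltW.
have err_e' : `|e'| <= 2 / q%:R.
  rewrite ler_pdivlMr ?(lt_le_trans _ Q1) // -[in X in _ * X](@ger0_norm _ q%:R) //.
  rewrite -normrM mulrC.
  have -> : q%:R * e' = q'%:~R * e + 1 by rewrite -[LHS](subrK (q'%:~R * e)) detE addrC.
  apply: (le_trans (ler_normD _ _)); rewrite normr1 normrM ger0_norm //.
  suff : q'%:~R * `|e| <= 1 by lra.
  apply: (@le_trans _ _ (q%:R * q%:R^-1)); first exact: ler_pM.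
  by rewrite divff // gt_eqF // (lt_le_trans _ Q1).
(* the solution of xi q + eta q' = 0, xi e + eta e' = c, as the determinant is 1 *)
set xi : R := - (c * q'%:~R); set eta : R := c * q%:R.
have [x [x0 x1 x3]] : exists x : int,
    [/\ x != 0, 1 <= x%:~R - xi & x%:~R - xi <= 3].
  (* x >= xi + 1 gives n >= q; two candidates ensure x != 0 *)
  have /andP[] := floor_itv xi; set f := Num.floor xi; rewrite intrD => f1 f2.
  have [f0|f0] := eqVneq (f + 2) 0; [exists (f + 3) | exists (f + 2)];
    rewrite intrD; split; try lra; by [|lia].
have X0 : (0 < `|x|%N)%N by rewrite absz_gt0.
have xB : `|x|%N%:R <= (`|c| + 3) * q%:R.
  have : `|xi| <= `|c| * q%:R.
    by rewrite normrN normrM (ger0_norm r0) ler_wpM2l.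
  rewrite natr_absz intr_norm mulrDl !ler_norml; lra.
set y0 := Num.floor eta.
(* y0 is reduced modulo x, as the sieve works with natural numbers *)
have [j /andP[j1 j2] cop] := coprime_in_interval `|x|%N `|(y0 %% x)%Z|%N X0.
have [y [y1 y2 cxy]] : exists y : int,
    [/\ y0 + 1 <= y, y <= y0 + (4 ^ size (primes `|x|%N))%N & coprimez x y].
  have m0 : 0 <= (y0 %% x)%Z by apply: modz_ge0.
  exists ((y0 %/ x)%Z * x + j); split; last by rewrite /coprimez gcdzMDl.
  - rewrite {1}(divz_eq y0 x) -(gez0_abs m0); lia.
  - rewrite {2}(divz_eq y0 x) -(gez0_abs m0); lia.
exists (x * p + y * p'), (x * q + y * q'), x => /=.
set H : R := (4 ^ _)%N%:R.
have H1 : 1 <= H by rewrite ler1n expn_gt0.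
have /andP[yf1 yf2] := floor_itv eta; rewrite -/y0 intrD in yf1 yf2.
have {}y1 : y0%:~R + 1 <= y%:~R :> R by rewrite -[1]/(1%:~R) -intrD ler_int.
have {}y2 : y%:~R <= y0%:~R + H by move: y2; rewrite -(ler_int R) intrD.
set X := x%:~R - xi in x1 x3.
have {y1 y2} [Y0 YH] : 0 <= y%:~R - eta /\ y%:~R - eta <= H by split; lra.
set Y := y%:~R - eta in Y0 YH.
have nE : (x * q + y * q')%:~R = X * q%:R + Y * q'%:~R.
  by rewrite intrD !intrM /X /Y /xi /eta -[q%:~R]/(q%:R); ring.
have errE : (x * q + y * q')%:~R * a - (x * p + y * p')%:~R - c = X * e + Y * e'.
  transitivity (X * e + Y * e' + c * (q'%:~R * p%:~R - q%:R * p'%:~R - 1)).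
    by rewrite !intrD !intrM -[q%:~R]/(q%:R) /X /Y /xi /eta /e /e'; ring.
  by rewrite detR subrr mulr0 addr0.
split => //.
- have [[u v] /= uv] := coprimezP _ _ cxy.
  apply/coprimezP; exists (u * q' - v * q, v * p - u * p') => /=.
  by transitivity ((u * x + v * y) * (q' * p - q%:Z * p')); [ring | rewrite uv det].
- rewrite nE; apply/andP; split.
    by apply: (@le_trans _ _ (X * q%:R)); [rewrite ler_peMl | rewrite lerDl mulr_ge0].
  apply: (@le_trans _ _ (3 * q%:R + H * q%:R)).
    by apply: lerD; apply: ler_pM => //; lra.
  by rewrite -mulrDl ler_pM2r ?(lt_le_trans _ Q1) //; lra.
- rewrite errE; apply: (le_trans (ler_normD _ _)); rewrite !normrM.
  apply: (@le_trans _ _ (3 * q%:R^-1 + H * (2 / q%:R))).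
    apply: lerD; apply: ler_pM => //; rewrite ger0_norm //; lra.
  rewrite mulrA -mulrDl ler_pM2r ?invr_gt0 ?(lt_le_trans _ Q1) //; lra.
Qed.

(** With n <= 4 H q, the claim follows from 20 H ^ 2 <= q ^ (4 d) for any
    exponent 4 d <= eps; one half of that power pays for H ^ 2 <= K ^ 2 q ^ (2 d),
    the other half for the constant 20 K ^ 2.  The bound 4 d <= 1 keeps the
    exponent of n nonnegative, so that n <= 4 H q can be used. *)
Lemma powR_absorb (R : realType) (eps d K H n q : R) :
  0 < d -> 4 * d <= 1 -> 4 * d <= eps -> 1 <= H -> 1 <= q -> H <= K * q `^ d ->
  20 * K ^+ 2 <= q `^ (2 * d) -> 1 <= n <= 4 * H * q ->
  5 * H / q <= 1 / n `^ (1 - eps).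
Proof.
move=> d0 d1 deps H1 q1 HK qK /andP[n1 nHq].
have q0 : 0 < q by lra.
have n0 : 0 < n by lra.
rewrite mul1r ler_pdivrMr // ler_pdivlMl ?powR_gt0 // mulrC.
apply: (@le_trans _ _ (5 * H * (4 * H * q `^ (1 - 4 * d)))).
  rewrite ler_pM2l; last by lra.
  apply: (@le_trans _ _ (n `^ (1 - 4 * d))); first by rewrite ler_powR //; lra.
  apply: (@le_trans _ _ ((4 * H * q) `^ (1 - 4 * d))).
    by rewrite ge0_ler_powR ?nnegrE //; lra.
  rewrite powRM; [|lra|lra]; rewrite ler_pM2r ?powR_gt0 //.
  by apply: ler1_powR; lra.
have qE : q = q `^ (1 - 4 * d) * (q `^ (2 * d) * (q `^ d) ^+ 2).
  have qne (r : R) : (r == 0) ==> (q != 0) by rewrite (gt_eqF q0); apply/implyP.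
  rewrite expr2 -!powRD ?qne //; transitivity (q `^ 1); first by rewrite powRr1 ?ltW.
  by congr (_ `^ _); ring.
rewrite [leRHS]qE.
set w := q `^ (1 - 4 * d).
have -> : 5 * H * (4 * H * w) = w * (20 * H ^+ 2) by ring.
rewrite ler_pM2l ?powR_gt0 //.
apply: (@le_trans _ _ (20 * K ^+ 2 * (q `^ d) ^+ 2)); last first.
  by rewrite ler_wpM2r // exprn_ge0 // powR_ge0.
rewrite -mulrA -exprMn ler_pM2l // lerXn2r // nnegrE; lra.
Qed.

Lemma inhomogeneous_approx (R : realType) (alpha gamma eps : R) (B : nat) :
  irrational alpha -> 0 < eps ->
  exists m n : int, [/\ coprimez m n, B%:Z < n &
    `| n%:~R * alpha - m%:~R - gamma | <= 1 / (`| n%:~R | `^ (1 - eps))].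
Proof.
move=> aI eps0.
set d : R := Num.min eps 1 / 4.
have [d0 d1 deps] : [/\ 0 < d, 4 * d <= 1 & 4 * d <= eps].
  have : 0 < Num.min eps 1 by rewrite lt_min eps0 ltr01.
  have : Num.min eps 1 <= eps by rewrite ge_min lexx.
  have : Num.min eps 1 <= 1 by rewrite ge_min lexx orbT.
  by rewrite /d; split; lra.
have [C C0 HC] := exp_size_primes_subpolynomial R d d0.
set c3 := `|gamma| + 3.
have c30 : 0 <= c3 by rewrite /c3; have := normr_ge0 gamma; lra.
set K := C * c3 `^ d.
(* q >= Q suffices for 20 K ^ 2 <= q ^ (2 d) *)
set Q := (20 * K ^+ 2) `^ (2 * d)^-1.
have Q0 : 0 <= Q by apply: powR_ge0.
have K20 : 0 <= 20 * K ^+ 2 by rewrite mulr_ge0 // sqr_ge0.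
have [q [p [Bq cpq err]]] := coprime_dirichlet R alpha (maxn B (Num.bound Q)) aI.
rewrite gtn_max in Bq; case/andP: Bq => Bq Qq.
have q0 : (0 < q)%N by apply: leq_ltn_trans Bq.
have qK : 20 * K ^+ 2 <= q%:R `^ (2 * d) :> R.
  have -> : 20 * K ^+ 2 = Q `^ (2 * d).
    by rewrite -powRrM mulVf ?powRr1 // gt_eqF // mulr_gt0.
  have Qle : Q <= q%:R.
    by apply/ltW/(lt_le_trans (archi_boundP Q0)); rewrite ler_nat ltnW.
  by rewrite ge0_ler_powR ?nnegrE // mulr_ge0 // ltW.
have [m [n [x]]] := lattice_point R alpha gamma q p q0 cpq err.
set H := _%:R => /= -[cmn [x0 xB] nB e].
have q1 : 1 <= q%:R :> R by rewrite ler1n.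
have n1 : 1 <= n%:~R :> R by case/andP: nB => + _; apply: le_trans.
have HK : H <= K * q%:R `^ d.
  apply: (le_trans (HC _ _)); first by rewrite absz_gt0.
  rewrite -mulrA ler_pM2l // -powRM //.
  by rewrite ge0_ler_powR ?(ltW d0) ?nnegrE ?mulr_ge0.
exists m, n; split => //.
  by rewrite -(ltr_int R) (@lt_le_trans _ _ q%:R) ?ltr_nat //; case/andP: nB.
apply: (le_trans e); rewrite (@ger0_norm _ n%:~R); last by lra.
apply: (@powR_absorb _ eps d K) => //.
  by rewrite ler1n expn_gt0.
by case/andP: nB => _ ->; rewrite n1.
Qed.

Theorem corollary1 (R : realType) (alpha gamma eps : R) :
  irrational alpha -> 0 < eps ->
  infinite_set [set mn : int * int |
    [/\ coprimez mn.1 mn.2, mn.2 != 0 &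
        `| mn.2%:~R * alpha - mn.1%:~R - gamma |
          <= 1 / (`| mn.2%:~R | `^ (1 - eps)) ]].
Proof.
move=> aI eps0 /finite_seqP[s sE].
set B := (\max_(mn <- s) `|mn.2|)%N.
have [m [n [cmn Bn e]]] := inhomogeneous_approx R alpha gamma eps B aI eps0.
have : (m, n) \in s.
  suff : [set` s] (m, n) by [].
  by rewrite -sE /=; split => //; rewrite gt_eqF // (le_lt_trans _ Bn).
move=> ins.
have : (`|n| <= B)%N by apply: (@leq_bigmax_seq _ _ predT (fun mn => `|mn.2|%N) (m, n)).
lia.
Qed.
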